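(* Let $K$ be a field of characteristic zero, $A$ an arbitrary $K$-algebra, and $\sigma_1,\ldots,\sigma_s\in\mathrm{Aut}_K(A)$ automorphisms of the algebra $A$. The following statements are equivalent. 1. The maps $\sigma_1-\mathrm{id}_A,\ldots,\sigma_s-\mathrm{id}_A$ are commuting locally nilpotent and there exist elements $x_1,\ldots,x_s\in A$ satisfying $\sigma_i(x_j)=x_j+\delta_{ij}$ (the Kronecker delta) for $1\le i,j\le s$. 2. $\sigma_1=e^{\delta_1},\ldots,\sigma_s=e^{\delta_s}$ for some commuting locally nilpotent derivations $\delta_1,\ldots,\delta_s\in\mathrm{Der}_K(A)$ such that $\delta_i(x_j)=\delta_{ij}$, $1\le i,j\le s$, for some elements $x_1,\ldots,x_s\in A$. If one of the two equivalent conditions holds then $\delta_i=\sum_{k\ge1}(-1)^{k+1}\frac{(\sigma_i-\mathrm{id}_A)^k}{k}$ for all $i$, $A^\delta=A^\sigma$, and the two sets of $x$'s (in 1 and in 2) coincide up to adding elements of $A^\sigma=A^\delta$.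
   Context: Algebras are associative and unital, not necessarily commutative. A $K$-linear map $\varphi:A\to A$ is locally nilpotent if for each $a\in A$, $\varphi^n(a)=0$ for all $n\gg1$. For a locally nilpotent derivation $\delta$, $e^\delta=\sum_{k\ge0}\frac{\delta^k}{k!}$. $A^\delta=\bigcap_{i=1}^s\ker\delta_i$ and $A^\sigma=\{a\in A\mid\sigma_1(a)=\cdots=\sigma_s(a)=a\}$. *)

(* Defs.v *)
From mathcomp Require Import all_boot all_order all_algebra.
From mathcomp Require Import boolp classical_sets fsbigop.

Set Implicit Arguments.
Unset Strict Implicit.
Unset Printing Implicit Defensive.

Import GRing.Theory.

Local Open Scope classical_set_scope.
Local Open Scope ring_scope.

Section LinearMaps.
Variables (K : fieldType) (V : lmodType K).

Definition locally_nilpotent (f : {linear V -> V}) :=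
  forall v, exists N, forall n, (N <= n)%N -> iter n f v = 0.

Definition commuting s (f : 'I_s -> {linear V -> V}) :=
  forall i j v, f i (f j v) = f j (f i v).

(* The sums below range over the finite support of their general term; by
   convention [\sum_(k \in D) F k] is 0 if that support is infinite, which does
   not happen when [f] (resp. [f - id]) is locally nilpotent. *)
Definition exp_map (f : {linear V -> V}) (v : V) : V :=
  \sum_(k \in [set: nat]) (k`!%:R^-1 *: iter k f v).

Definition log_map (f : {linear V -> V}) (v : V) : V :=
  \sum_(k \in [set k | (1 <= k)%N])
    (((-1) ^+ k.+1 / k%:R) *: iter k (f \- idfun) v).

Definition joint_ker s (f : 'I_s -> {linear V -> V}) : set V :=
  \bigcap_(i in [set: 'I_s]) [set v | f i v = 0].

Definition joint_fix s (f : 'I_s -> {linear V -> V}) : set V :=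
  [set v | forall i, f i v = v].

End LinearMaps.

Section Algebra.
Variables (K : fieldType) (A : algType K).

Definition derivation (d : {linear A -> A}) :=
  forall a b, d (a * b) = d a * b + a * d b.

Variables (s : nat).
Implicit Types sigma delta : 'I_s -> {linear A -> A}.

Definition aut_coords sigma : set ('I_s -> A) :=
  [set x | forall i j, sigma i (x j) = x j + (i == j)%:R].

Definition der_coords delta : set ('I_s -> A) :=
  [set x | forall i j, delta i (x j) = (i == j)%:R].

Definition unipotent_with_coords sigma :=
  [/\ forall i, locally_nilpotent (sigma i \- idfun),
      commuting (fun i => sigma i \- idfun : {linear A -> A})
    & exists x, aut_coords sigma x].

Definition exponential_of sigma delta :=
  [/\ forall i, derivation (delta i),
      forall i, locally_nilpotent (delta i),
      commuting delta,
      forall i, sigma i =1 exp_map (delta i)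
    & exists x, der_coords delta x].

End Algebra.

(* Main.v *)
(* If [sigma - id] is locally nilpotent then, for each [v],
     sigma^n v = \sum_k 'C(n, k) (sigma - id)^k v
   is a polynomial in [n] whose coefficient at [n^1] is [log sigma v]. In
   characteristic zero the coefficients are determined by the values at the
   natural numbers, so identities between orbits pass to coefficients:
   - [sigma^n (a b) = sigma^n a * sigma^n b] makes [log sigma] a derivation;
   - [sigma^(n + m) = sigma^n sigma^m] shows that differentiating in [n] is
     applying [log sigma], so the coefficient at [n^j] is
     [(log sigma)^j v / j`!], and [n = 1] gives [sigma = exp (log sigma)];
   - if [sigma = exp d] then [sigma^n = exp (n d)], so [d = log sigma]. *)
Require Import Defs.
From HB Require Import structures.
From mathcomp Require Import all_boot all_order all_algebra.
From mathcomp Require Import boolp classical_sets fsbigop.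

Set Implicit Arguments.
Unset Strict Implicit.
Unset Printing Implicit Defensive.

Import GRing.Theory.

Local Open Scope classical_set_scope.
Local Open Scope ring_scope.

(** * Interpolation at the natural numbers and binomial polynomials *)

Section Interpolation.
Variables (K : fieldType) (charK0 : [pchar K] =i pred0).

Let natr_eq0 n : (n%:R == 0 :> K) = (n == 0%N).
Proof. exact: (pcharf0P K).1. Qed.

Let natr_inj : injective (fun n => n%:R : K).
Proof.
suff le m n : (m <= n)%N -> m%:R = n%:R :> K -> m = n.
  move=> m n /= e; case/orP: (leq_total m n) => h; first exact: le.
  by symmetry; apply: le.
move=> h /eqP; rewrite eq_sym -subr_eq0 -natrB// natr_eq0 subn_eq0 => h'.
by apply/eqP; rewrite eqn_leq h.
Qed.

(** The nodes [0, ..., M-1] are distinct in characteristic zero, so their Vandermonde matrix is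
    invertible; [c] is column [j] of its inverse, the same for all [p]. *)
Lemma coef_of_values M (j : 'I_M) : exists c : 'I_M -> K,
  forall p : {poly K}, (size p <= M)%N -> \sum_(n < M) c n * p.[n%:R] = p`_j.
Proof.
pose W := Vandermonde M (\row_(n < M) (n%:R : K)).
have Wu : W \in unitmx.
  rewrite unitmxE det_Vandermonde unitfE; apply/prodf_neq0 => i _.
  apply/prodf_neq0 => k ltik; rewrite !mxE subr_eq0; apply/eqP => /natr_inj e.
  by rewrite e ltnn in ltik.
exists (fun n => invmx W n j) => p szp.
under eq_bigr => n _ do rewrite (horner_coef_wide _ szp) mulr_sumr.
rewrite exchange_big /=.
transitivity (\sum_(i < M) p`_i * (W *m invmx W) i j).
  apply: eq_bigr => i _; rewrite mxE mulr_sumr; apply: eq_bigr => n _.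
  by rewrite !mxE mulrC -mulrA.
rewrite mulmxV// (bigD1 j)//= mxE eqxx mulr1 big1 ?addr0// => i /negPf ne.
by rewrite mxE ne mulr0.
Qed.

(* A polynomial with coefficients in [V] is encoded as [\sum_i p_i(t) w_i], so
   that products and substitutions can be carried out on the scalar [p_i]. *)
Lemma eq_coef_of_values (V : lmodType K) (I J : finType)
    (p : I -> {poly K}) (w : I -> V) (q : J -> {poly K}) (u : J -> V) :
    (forall n : nat,
       \sum_i (p i).[n%:R] *: w i = \sum_j (q j).[n%:R] *: u j) ->
  forall k, \sum_i (p i)`_k *: w i = \sum_j (q j)`_k *: u j.
Proof.
move=> e k.
pose M := (\max_i size (p i) + \max_j size (q j) + k.+1)%N.
have ltkM : (k < M)%N by rewrite ltn_addl.
have [c cE] := coef_of_values (Ordinal ltkM).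
have pE i : (p i)`_k = \sum_(n < M) c n * (p i).[n%:R].
  rewrite cE// /M -addnA.
  by rewrite (leq_trans (leq_bigmax (F := fun i => size (p i)) i))// leq_addr.
have qE j : (q j)`_k = \sum_(n < M) c n * (q j).[n%:R].
  rewrite cE// /M -addnA addnCA.
  by rewrite (leq_trans (leq_bigmax (F := fun j => size (q j)) j))// leq_addr.
under eq_bigr do rewrite pE scaler_suml.
under [RHS]eq_bigr do rewrite qE scaler_suml.
rewrite exchange_big [RHS]exchange_big; apply: eq_bigr => n _ /=.
under eq_bigr do rewrite -scalerA.
under [RHS]eq_bigr do rewrite -scalerA.
by rewrite -!scaler_sumr e.
Qed.

(** The binomial coefficient [C(t, k)] as a polynomial in [t]: Newton's basis for finite
    differences. *)
Definition binom_poly k : {poly K} :=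
  k`!%:R^-1 *: \prod_(i < k) ('X - i%:R%:P).

Lemma horner_binom_poly k n : (binom_poly k).[n%:R] = 'C(n, k)%:R.
Proof.
rewrite hornerZ horner_prod.
have -> : \prod_(i < k) ('X - (i%:R : K)%:P).[n%:R] = (n ^_ k)%:R.
  elim: k => [|k IH]; first by rewrite big_ord0 ffactn0.
  rewrite big_ord_recr /= IH ffactnSr natrM hornerXsubC.
  case: (leqP k n) => h; first by rewrite natrB.
  by rewrite ffact_small// !mul0r.
by rewrite -bin_ffact natrM mulrCA mulVf ?mulr1// natr_eq0 -lt0n fact_gt0.
Qed.

Lemma binom_poly0 k : (binom_poly k)`_0 = (k == 0)%:R.
Proof.
by rewrite -horner_coef0 (horner_binom_poly k 0) bin0n eq_sym; case: k.
Qed.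

Lemma binom_poly1 k : (binom_poly k)`_1 = (-1) ^+ k.+1 / k%:R.
Proof.
(* Both sides vanish at [k = 0] because [0^-1 = 0]. *)
case: k => [|k].
  by rewrite /binom_poly big_ord0 coefZ coefC /= invr0 !mulr0.
have -> : (-1) ^+ k.+2 = (-1) ^+ k :> K.
  by rewrite -addn2 exprD sqrrN expr1n mulr1.
(* The factor for [i = 0] is ['X], which leaves the value at [0] of the product of the others. *)
rewrite /binom_poly big_ord_recl coefZ subr0 coefXM /=.
rewrite -horner_coef0 horner_prod.
have -> : \prod_(i < k) ('X - ((bump 0 i)%:R : K)%:P).[0] = (-1) ^+ k * k`!%:R.
  elim: k => [|k IH]; first by rewrite big_ord0 mulr1.
  rewrite big_ord_recr /= IH hornerXsubC sub0r factS natrM exprS.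
  by rewrite mulrN mulN1r mulNr -mulrA [X in _ * X]mulrC.
rewrite factS natrM invfM mulrC -mulrA; congr (_ * _); rewrite mulrCA.
by rewrite mulfV ?mulr1// natr_eq0 -lt0n fact_gt0.
Qed.

End Interpolation.

(** * Truncation of sums with finite support *)

Lemma sum_ord_support (V : nmodType) (F : nat -> V) N M : (N <= M)%N ->
  (forall k, (N <= k)%N -> F k = 0) -> \sum_(k < M) F k = \sum_(k < N) F k.
Proof.
move=> leNM F0; rewrite (big_ord_widen M F leNM) [RHS]big_mkcond.
apply: eq_bigr => k _; case: ltnP => // h; exact: F0.
Qed.

Lemma fsum_ord_support (V : nmodType) (F : nat -> V) N :
  (forall k, (N <= k)%N -> F k = 0) ->
  \sum_(k \in [set: nat]) F k = \sum_(k < N) F k.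
Proof.
move=> F0; rewrite fsbig_ord; symmetry; apply: fsbig_widen => // k [_ /= /negP].
by rewrite -leqNgt => /F0.
Qed.

(** * Iterates of locally nilpotent linear maps *)

Section LinearIteration.
Variables (K : fieldType) (V : lmodType K).
Implicit Types f g : {linear V -> V}.

Fact iter_linear k f : linear (iter k f).
Proof. by elim: k => [|k IH] a u v //=; rewrite IH linearP. Qed.

HB.instance Definition _ k f :=
  GRing.isLinear.Build K V V *:%R (iter k f) (iter_linear k f).

Lemma iter0_ge f N k v : (N <= k)%N -> iter N f v = 0 -> iter k f v = 0.
Proof. by move=> le fv0; rewrite -(subnK le) iterD fv0 linear0. Qed.

Lemma iter_commute f g k :
  (forall v, f (g v) = g (f v)) -> forall v, iter k f (g v) = g (iter k f v).
Proof. by move=> fg v; elim: k => //= k ->; rewrite fg. Qed.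

Lemma nilpotent_common f s (v : 'I_s -> V) : locally_nilpotent f ->
  exists N, forall i, iter N f (v i) = 0.
Proof.
move=> nf; have [N NP] := choice (fun i => nf (v i)).
by exists (\max_i N i)%N => i; apply: (NP i); apply: leq_bigmax.
Qed.

(** Newton's forward difference formula: split [sigma v = v + (sigma v - v)] and use Pascal's rule;
    the second summand is killed one power earlier. *)
Lemma iter_binomial (sigma : {linear V -> V}) n N v :
  iter N (sigma \- idfun) v = 0 ->
  iter n sigma v = \sum_(k < N) 'C(n, k)%:R *: iter k (sigma \- idfun) v.
Proof.
elim: n v N => [|n IH] v [|N] fv0.
- by rewrite big_ord0 -fv0.
- rewrite big_ord_recl scale1r big1 ?addr0// => k _.
  by rewrite bin0n /= scale0r.
- by rewrite big_ord0 -[v]/(iter 0 (sigma \- idfun) v) fv0 linear0.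
rewrite iterSr -[sigma v](subrK v) addrC linearD /= (IH v N.+1)//.
rewrite (IH (sigma v - v) N); last by rewrite -fv0 iterSr.
rewrite !big_ord_recl !bin0 -addrA; congr (_ + _).
rewrite -big_split; apply: eq_bigr => k _ /=.
by rewrite binS natrD scalerDl -iterSr.
Qed.

Lemma exp_mapE f N v : iter N f v = 0 ->
  exp_map f v = \sum_(k < N) k`!%:R^-1 *: iter k f v.
Proof.
move=> fv0; apply: fsum_ord_support => k le.
by rewrite (iter0_ge le fv0) scaler0.
Qed.

Lemma log_mapE f N v : iter N (f \- idfun) v = 0 ->
  log_map f v =
  \sum_(k < N) ((-1) ^+ k.+1 / k%:R) *: iter k (f \- idfun) v.
Proof.
move=> fv0.
rewrite -(@fsum_ord_support _
  (fun k => ((-1) ^+ k.+1 / k%:R) *: iter k (f \- idfun) v)); last first.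
  by move=> k le; rewrite (iter0_ge le fv0) scaler0.
(* The extra term [k = 0] carries the factor [0^-1 = 0]. *)
apply: fsbig_widen => // -[|k] [_ //= _].
by rewrite invr0 mulr0 scale0r.
Qed.

(** Without a constant term, each application of [g] uses up at least one power of [f]: if [f^N]
    kills [v], so does [g^N]. *)
Lemma nilpotent_series f g (c : nat -> K) : locally_nilpotent f ->
  (forall N v, iter N f v = 0 ->
     g v = \sum_(k < N | (0 < k)%N) c k *: iter k f v) ->
  locally_nilpotent g.
Proof.
move=> nf gE v; have [N /(_ N (leqnn N)) fv0] := nf v.
exists N => n le; apply: (iter0_ge le).
elim: N v fv0 {n le} => // N IH v fv0.
rewrite iterSr (gE _ _ fv0) linear_sum big1// => k k0.
rewrite linearZ /= IH ?scaler0// -iterD -(prednK k0).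
by rewrite addnS -addSn addnC iterD fv0 linear0.
Qed.

End LinearIteration.

(** * Logarithm and exponential of linear maps *)

Section ExpLog.
Variables (K : fieldType) (charK0 : [pchar K] =i pred0) (V : lmodType K).
Implicit Types sigma g d : {linear V -> V}.

Lemma iter_binom_poly sigma n N v : iter N (sigma \- idfun) v = 0 ->
  iter n sigma v =
  \sum_(k < N) (binom_poly K k).[n%:R] *: iter k (sigma \- idfun) v.
Proof.
move=> fv0; rewrite (iter_binomial n fv0); apply: eq_bigr => k _.
by rewrite horner_binom_poly.
Qed.

(* [log sigma] reads off the linear coefficient of the polynomial orbit map
   [n |-> sigma^n v]. *)
Lemma log_of_orbit sigma (I : finType) (p : I -> {poly K}) (w : I -> V) v :
  locally_nilpotent (sigma \- idfun) ->
  (forall n, iter n sigma v = \sum_i (p i).[n%:R] *: w i) ->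
  log_map sigma v = \sum_i (p i)`_1 *: w i.
Proof.
move=> nf orb; have [N /(_ N (leqnn N)) fv0] := nf v.
rewrite (log_mapE fv0).
under eq_bigr => k _ do rewrite -(binom_poly1 charK0).
apply: (eq_coef_of_values charK0) => n.
by rewrite -orb (iter_binom_poly _ fv0).
Qed.

Lemma log_linear sigma : locally_nilpotent (sigma \- idfun) ->
  linear (log_map sigma).
Proof.
move=> nf a u v.
have [N nilp] := nilpotent_common
  (tnth [tuple u; v; a *: u + v]) nf.
have fu := nilp 0; have fv := nilp 1; have fauv := nilp 2%:R.
rewrite !(tnth_nth 0) /= in fu fv fauv.
rewrite (log_mapE fu) (log_mapE fv) (log_mapE fauv) scaler_sumr -big_split.
apply: eq_bigr => k _; rewrite linearP scalerDr !scalerA; congr (_ *: _ + _).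
exact: mulrC.
Qed.

(** The nilpotency proof is a parameter so that the linear structure, which depends on it, can be
    inferred. *)
Definition log_linmap sigma (_ : locally_nilpotent (sigma \- idfun)) : V -> V :=
  log_map sigma.

HB.instance Definition _ sigma (nf : locally_nilpotent (sigma \- idfun)) :=
  GRing.isLinear.Build K V V *:%R (log_linmap nf) (log_linear nf).

Lemma log_commute sigma g : locally_nilpotent (sigma \- idfun) ->
  (forall v, (sigma \- idfun) (g v) = g ((sigma \- idfun) v)) ->
  forall v, log_map sigma (g v) = g (log_map sigma v).
Proof.
move=> nf comm v; have [N /(_ N (leqnn N)) fv0] := nf v.
have fgv0 : iter N (sigma \- idfun) (g v) = 0.
  by rewrite iter_commute// fv0 linear0.
rewrite (log_mapE fv0) (log_mapE fgv0) linear_sum; apply: eq_bigr => k _.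
by rewrite linearZ iter_commute.
Qed.

Lemma exp_commute d g : locally_nilpotent d ->
  (forall v, d (g v) = g (d v)) ->
  forall v, exp_map d (g v) = g (exp_map d v).
Proof.
move=> nd comm v; have [N /(_ N (leqnn N)) dv0] := nd v.
have dgv0 : iter N d (g v) = 0 by rewrite iter_commute// dv0 linear0.
rewrite (exp_mapE dv0) (exp_mapE dgv0) linear_sum; apply: eq_bigr => k _.
by rewrite linearZ iter_commute.
Qed.

Lemma log_map_posE sigma v N : iter N (sigma \- idfun) v = 0 ->
  log_map sigma v = \sum_(k < N | (0 < k)%N)
    ((-1) ^+ k.+1 / k%:R) *: iter k (sigma \- idfun) v.
Proof.
move=> fv0; rewrite (log_mapE fv0) [RHS]big_mkcond.
apply: eq_bigr => -[[|k] ?] _ //=.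
by rewrite invr0 mulr0 scale0r.
Qed.

Lemma iter_log_eq0 sigma v N : locally_nilpotent (sigma \- idfun) ->
  iter N (sigma \- idfun) v = 0 ->
  iter N (sigma \- idfun) (log_map sigma v) = 0.
Proof.
move=> nf fv0; rewrite -[LHS](log_commute (g := iter N (sigma \- idfun)))//=.
  by rewrite fv0 (log_mapE (N := 0) erefl) big_ord0.
by move=> x; exact: (iterSr N (sigma \- idfun) x).
Qed.

(* Differentiating [n |-> sigma^n v] amounts to applying [log sigma]. *)
Lemma coef_orbit_log sigma v N j : locally_nilpotent (sigma \- idfun) ->
  iter N (sigma \- idfun) v = 0 ->
  \sum_(k < N) (binom_poly K k)`_j *: iter k (sigma \- idfun) (log_map sigma v)
  = \sum_(k < N) (binom_poly K k)^`()`_j *: iter k (sigma \- idfun) v.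
Proof.
move=> nf fv0; apply: (eq_coef_of_values charK0) => m.
rewrite -(iter_binom_poly _ (iter_log_eq0 nf fv0)).
rewrite -[LHS](log_commute (g := iter m sigma))//=; last first.
  by move=> x /=; rewrite linearB /= -iterS iterSr.
pose p k := binom_poly K k \Po ('X + (m%:R)%:P).
(* The shifted polynomials [p k] describe [n |-> sigma^(n + m) v]; their linear coefficients are the
   derivatives of the binomial polynomials at [m]. *)
rewrite (log_of_orbit (p := fun k : 'I_N => p k)
  (w := fun k : 'I_N => iter k (sigma \- idfun) v))//.
  apply: eq_bigr => k _; congr (_ *: _).
  rewrite -[LHS]mulr1n -coef_deriv -horner_coef0 deriv_comp derivD derivX.
  by rewrite derivC addr0 mulr1 horner_comp !hornerE.
move=> n; rewrite -iterD (iter_binom_poly _ fv0); apply: eq_bigr => k _.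
by rewrite horner_comp !hornerE natrD.
Qed.

(** Each application of the logarithm differentiates the orbit polynomial, and [j] derivatives bring
    the coefficient at [t^j] to the constant term with factor [j!]. *)
Lemma iter_log sigma v N j : locally_nilpotent (sigma \- idfun) ->
  iter N (sigma \- idfun) v = 0 ->
  iter j (log_map sigma) v =
  j`!%:R *: \sum_(k < N) (binom_poly K k)`_j *: iter k (sigma \- idfun) v.
Proof.
move=> nf; elim: j v => [|j IH] v fv0.
  rewrite scale1r -[LHS]/(iter 0 sigma v) (iter_binom_poly _ fv0).
  by apply: eq_bigr => k _; rewrite -horner_coef0.
rewrite iterSr IH; last exact: iter_log_eq0.
rewrite coef_orbit_log// factS mulnC natrM -scalerA; congr (_ *: _).
rewrite scaler_sumr; apply: eq_bigr => k _.
by rewrite coef_deriv scalerA mulr_natl.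
Qed.

Lemma fact_neq0 k : k`!%:R != 0 :> K.
Proof. by rewrite (pcharf0P K).1// -lt0n fact_gt0. Qed.

Lemma size_binom_poly k : (size (binom_poly K k) <= k.+1)%N.
Proof.
rewrite (leq_trans (size_scale_leq _ _))//.
by rewrite size_prod_XsubC [index_enum _]unlock -enumT size_enum_ord.
Qed.

Lemma exp_log sigma d : locally_nilpotent (sigma \- idfun) ->
  d =1 log_map sigma -> sigma =1 exp_map d.
Proof.
move=> nf dE v; have [N /(_ N (leqnn N)) fv0] := nf v.
have iterd j : iter j d v = j`!%:R *: \sum_(k < N)
    (binom_poly K k)`_j *: iter k (sigma \- idfun) v.
  by rewrite (eq_iter dE) (iter_log j nf fv0).
(* The orbit polynomial has degree below [N], so its coefficient at [t^N] is zero and the same [N]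
   truncates the exponential. *)
have dv0 : iter N d v = 0.
  rewrite iterd big1 ?scaler0// => k _.
  by rewrite nth_default ?scale0r// (leq_trans (size_binom_poly k)).
(* Evaluating the orbit polynomial at [1] sums its coefficients. *)
rewrite (exp_mapE dv0) -[LHS]/(iter 1 sigma v) (iter_binom_poly _ fv0).
under [RHS]eq_bigr => j _ do
  rewrite iterd scalerA mulVf ?fact_neq0// scale1r.
rewrite exchange_big; apply: eq_bigr => k _ /=.
rewrite -scaler_suml (horner_coef_wide (n := N)).
  by congr (_ *: _); apply: eq_bigr => i _; rewrite expr1n mulr1.
exact: leq_trans (size_binom_poly k) _.
Qed.

(** Induction on [n] through [e^d e^(n d) = e^((n+1) d)]: a Cauchy product regrouped by total
    degree, then the binomial theorem. *)
Lemma iter_exp sigma d n v N : sigma =1 exp_map d -> iter N d v = 0 ->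
  iter n sigma v = \sum_(k < N) (n%:R ^+ k / k`!%:R) *: iter k d v.
Proof.
move=> sE dv0; elim: n => [|n IH].
  case: N dv0 => [<-|N _]; first by rewrite big_ord0.
  rewrite big_ord_recl divr1 scale1r big1 ?addr0// => k _.
  by rewrite expr0n mul0r scale0r.
rewrite iterS IH linear_sum /=.
pose F k m := (n%:R ^+ k / k`!%:R / (m - k)`!%:R) *: iter m d v.
transitivity (\sum_(k < N) \sum_(m < N | (k <= m)%N) F k m).
  apply: eq_bigr => k _; rewrite linearZ /= sE.
  have dkv0 : iter N d (iter k d v) = 0.
    by rewrite -iterD addnC iterD dv0 linear0.
  rewrite (exp_mapE dkv0) scaler_sumr.
  transitivity (\sum_(l < N) F k (l + k)%N).
    by apply: eq_bigr => l _; rewrite /F addnK scalerA iterD.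
  rewrite -(big_mkord xpredT (fun l => F k (l + k)%N)).
  rewrite -{1}[N](addnK k) -(big_addn 0 _ _ xpredT (F k)) add0n.
  (* Terms of total degree [m >= N] vanish because [d^N v = 0]. *)
  rewrite (big_cat_nat (n := N)) ?leq_addr 1?ltnW//=.
  have -> : \sum_(N <= m < N + k) F k m = 0.
    rewrite big_nat big1 // => m /andP[le _].
    by rewrite /F (iter0_ge le dv0) scaler0.
  by rewrite addr0 big_geq_mkord.
rewrite (exchange_big_dep xpredT) //=; apply: eq_bigr => m _.
rewrite -scaler_suml; congr (_ *: _).
rewrite -nat1r exprDn mulr_suml.
rewrite (big_ord_widen N
  (fun k => (1 ^+ (m - k) * n%:R ^+ k) *+ 'C(m, k) / m`!%:R))//.
apply: eq_bigr => k lekm; rewrite expr1n mul1r -(bin_fact lekm) !natrM !invfM.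
rewrite -[_ *+ 'C(m, k)]mulr_natr -!mulrA; congr (_ * _).
rewrite mulrA mulfV ?mul1r//.
(* The binomial coefficient is nonzero in [K] since it divides [m!]. *)
apply: contraTneq (fact_neq0 m) => e.
by rewrite -(bin_fact lekm) natrM e mul0r eqxx.
Qed.

Lemma log_exp sigma d : locally_nilpotent (sigma \- idfun) ->
  locally_nilpotent d -> sigma =1 exp_map d -> d =1 log_map sigma.
Proof.
(* Truncating at [N.+2] makes the terms of degree [0] and [1] available for splitting off. *)
move=> nf nd sE v; have [N /(_ N.+2) dv0] := nd v.
have {}dv0 : iter N.+2 d v = 0 by apply: dv0; rewrite -addn2 leq_addr.
pose p (k : nat) : {poly K} := k`!%:R^-1 *: 'X^k.
rewrite (log_of_orbit (p := fun k : 'I_N.+2 => p k)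
  (w := fun k : 'I_N.+2 => iter k d v))//; last first.
  move=> n; rewrite (iter_exp n sE dv0); apply: eq_bigr => k _.
  by rewrite hornerZ hornerXn mulrC.
rewrite !big_ord_recl big1 ?addr0 => [|k _]; last first.
  by rewrite coefZ coefXn mulr0 scale0r.
by rewrite !coefZ !coefXn /= mulr0 scale0r add0r mulr1 invr1 scale1r.
Qed.

Lemma exp_nilpotent sigma d : locally_nilpotent d -> sigma =1 exp_map d ->
  locally_nilpotent (sigma \- idfun).
Proof.
move=> nd sE; apply: (nilpotent_series (c := fun k => k`!%:R^-1) nd).
move=> [|N] v dv0; rewrite /= sE (exp_mapE dv0).
  by rewrite !big_ord0 -[v]/(iter 0 d v) dv0 subr0.
rewrite big_ord_recl [in RHS]big_mkcond big_ord_recl /=.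
by rewrite invr1 scale1r add0r addrC addKr.
Qed.

(** Serves coordinates and fixed vectors, where the series stops at first order. *)
Lemma log_map2 sigma v : (sigma \- idfun) ((sigma \- idfun) v) = 0 ->
  log_map sigma v = sigma v - v.
Proof.
move=> fv0; rewrite (log_mapE (N := 2) fv0) !big_ord_recr big_ord0 /=.
by rewrite invr0 mulr0 scale0r !add0r divr1 expr2 mulN1r opprK scale1r.
Qed.

Lemma exp_map2 d v : d (d v) = 0 -> exp_map d v = v + d v.
Proof.
move=> dv0; rewrite (exp_mapE (N := 2) dv0) !big_ord_recr big_ord0 /=.
by rewrite invr1 !scale1r add0r.
Qed.

End ExpLog.

(** * Derivations and the equivalence *)

Lemma log_derivation (K : fieldType) (charK0 : [pchar K] =i pred0)
    (A : algType K) (sigma : {lrmorphism A -> A}) (d : {linear A -> A}) :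
  locally_nilpotent (sigma \- idfun) -> d =1 log_map sigma -> derivation d.
Proof.
move=> nf dE a b; rewrite !dE; set f := sigma \- idfun in nf *.
have [Na /(_ (maxn Na _) (leq_maxl _ _)) na] := nf a.
have [Nb /(_ (maxn Na Nb) (leq_maxr _ _)) nb] := nf b.
move/(_ Nb): na; set N := maxn Na Nb in nb * => na.
pose B k := binom_poly K k.
(* The orbit of [a * b] is the product of the two orbit polynomials; the linear coefficient
   [p_0 q_1 + p_1 q_0] of a product yields the Leibniz rule. *)
rewrite (log_of_orbit charK0 (I := ('I_N * 'I_N)%type)
  (p := fun kl => B kl.1 * B kl.2)
  (w := fun kl => iter kl.1 f a * iter kl.2 f b))//; last first.
  move=> n; have -> : iter n sigma (a * b) = iter n sigma a * iter n sigma b.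
    by elim: n => //= n ->; rewrite rmorphM.
  rewrite (iter_binom_poly charK0 n na) (iter_binom_poly charK0 n nb).
  rewrite big_distrlr pair_bigA; apply: eq_bigr => kl _ /=.
  by rewrite hornerM -scalerAl -scalerAr scalerA.
have id_sum u : iter N f u = 0 -> \sum_(k < N) (B k)`_0 *: iter k f u = u.
  move=> fu0; rewrite -[RHS]/(iter 0 sigma u) (iter_binom_poly charK0 0 fu0).
  by apply: eq_bigr => k _; rewrite -horner_coef0.
have log_sum u : iter N f u = 0 ->
    \sum_(k < N) (B k)`_1 *: iter k f u = log_map sigma u.
  by move=> fu0; symmetry; apply: log_of_orbit => // n; exact: iter_binom_poly.
rewrite -[X in _ = _ * X + _](id_sum b nb) -[X in _ = _ + X * _](id_sum a na).
rewrite -(log_sum a na) -(log_sum b nb).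
rewrite !big_distrlr !pair_bigA -big_split; apply: eq_bigr => -[k l] _ /=.
rewrite coefM !big_ord_recr big_ord0 /= add0r subn0 subnn.
by rewrite -!scalerAl -!scalerAr !scalerA -scalerDl addrC.
Qed.

Lemma derivation1 (K : fieldType) (A : algType K) (d : {linear A -> A}) :
  derivation d -> d 1 = 0.
Proof.
move=> /(_ 1 1); rewrite mulr1 mul1r mulr1 => /eqP.
by rewrite -subr_eq subrr eq_sym => /eqP.
Qed.

Theorem theorem3p2 (K : fieldType) (charK0 : [pchar K] =i pred0)
    (A : algType K) (s : nat) (sigma : 'I_s -> {lrmorphism A -> A})
    (aut_sigma : forall i, bijective (sigma i)) :
  (unipotent_with_coords sigma <-> exists delta, exponential_of sigma delta)
  /\
  (forall delta, exponential_of sigma delta ->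
     [/\ forall i, delta i =1 log_map (sigma i),
         joint_ker delta = joint_fix sigma,
         forall x, aut_coords sigma x ->
           forall y, der_coords delta y <->
             (forall j, joint_fix sigma (y j - x j))
       & forall y, der_coords delta y ->
           forall x, aut_coords sigma x <->
             (forall j, joint_fix sigma (x j - y j))]).
Proof.
(* Here [sigma i - id] sends [x j] to [0] or [1], which ring morphisms fix, so only the first-order
   term of the logarithm survives. *)
have aut_der (delta : 'I_s -> {linear A -> A}) x :
    (forall i, delta i =1 log_map (sigma i)) ->
    aut_coords sigma x -> der_coords delta x.
  move=> logE ax i j; have fx : sigma i (x j) - x j = (i == j)%:R.
    by rewrite ax addrAC subrr add0r.
  by rewrite logE log_map2 /= fx // rmorph_nat subrr.
have der_aut (delta : 'I_s -> {linear A -> A}) y : exponential_of sigma delta ->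
    der_coords delta y -> aut_coords sigma y.
  move=> [dd nd _ expE _] dy i j; rewrite expE exp_map2 ?dy//.
  by rewrite raddfMn /= derivation1// mul0rn.
split; [split|].
- move=> [nf comm [x ax]].
  pose delta i : {linear A -> A} := log_linmap (nf i).
  have logE i : delta i =1 log_map (sigma i) by [].
  exists delta; split.
  + by move=> i; apply: log_derivation (nf i) _.
  + move=> i.
    apply: (nilpotent_series (c := fun k => (-1) ^+ k.+1 / k%:R) (nf i)).
    by move=> N v fv0; rewrite logE (log_map_posE fv0).
  (* Commutation passes to the logarithms one factor at a time. *)
  + move=> i j v; rewrite ![delta i _]logE; apply: log_commute => // u.
    by symmetry; apply: log_commute => // w; apply: comm.
  + by move=> i; apply: exp_log.
  + by exists x; apply: aut_der.
- move=> [delta edelta]; have [dd nd comm expE [y dy]] := edelta.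
  split; last by exists y; apply: der_aut dy.
  + by move=> i; apply: exp_nilpotent (nd i) (expE i).
  + move=> i j v; have scomm u : sigma i (sigma j u) = sigma j (sigma i u).
      rewrite (expE i) [sigma i u]expE; apply: exp_commute => // w.
      by rewrite !expE; symmetry; apply: exp_commute => // z; apply: comm.
    rewrite /= (linearB (sigma i)) (linearB (sigma j)) /= scomm !opprB.
    by rewrite addrACA [RHS]addrACA; congr (_ + _); rewrite addrC.
move=> delta edelta; have [dd nd comm expE _] := edelta.
have nf i : locally_nilpotent (sigma i \- idfun).
  exact: exp_nilpotent (nd i) (expE i).
have logE i : delta i =1 log_map (sigma i).
  exact: log_exp (nf i) (nd i) (expE i).
(* When [delta i] or [sigma i - id] kills [v], so do its higher powers, and the series for the other
   map shows that it kills [v] too. *)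
have kerE i v : delta i v = 0 <-> sigma i v = v.
  split=> [dv0|fv].
    by rewrite expE exp_map2 dv0 ?addr0 ?linear0.
  by rewrite logE log_map2 /= fv !(subrr, linear0).
split=> //.
- apply/seteqP; split=> v /= h i; first exact/kerE/h.
  by move=> _; apply/kerE/h.
(* By [aut_der], [x] is also a coordinate system for [delta]; two such systems differ by the joint
   kernel, that is, by fixed elements. *)
- move=> x /(aut_der _ _ logE) dx y; split=> [dy j i|fix_yx i j].
    by apply/kerE; rewrite linearB /= dy dx subrr.
  rewrite -(dx i j) -[y j](subrK (x j)) linearD (kerE _ _).2 ?add0r//.
  exact: fix_yx.
- move=> y /(der_aut _ _ edelta) ay x; split=> [ax j i|fix_xy i j].
    by rewrite linearB /= ax ay opprD addrACA subrr addr0.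
  by rewrite -[x j](subrK (y j)) linearD /= fix_xy ay addrA.
Qed.
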